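(* Let $n,N,l$ be positive integers, let $A_1,\ldots,A_N,B_1,\ldots,B_N\in\mathbb{R}^{n\times n}$ be (entrywise) nonnegative matrices, and let $f:\mathbb{R}^n\to\mathbb{R}^n$ be an admissible diagonal nonlinearity. Let $M_1=\{(A_s+B_r)^T : 1\le s,r\le N\}$ and $M_2=\{A_s+B_s : 1\le s\le N\}$, and let $$\rho_1=\max\{\rho(A)\mid A\in\mathcal{R}(M_1)\},\qquad \rho_2=\max\{\rho(A)\mid A\in\mathcal{R}(M_2)\}.$$ If $\rho_1\rho_2<1$, then the switched system $$x(k+1)=A_{\sigma(k)}f(x(k))+B_{\sigma(k)}f(x(k-l))$$ is diagonally stable.
   Context: $\rho(A)$ denotes the spectral radius of $A$. For a finite set $M$ of $n\times n$ matrices, the row selection set $\mathcal{R}(M)$ consists of all $n\times n$ matrices such that, for each $i=1,\ldots,n$, the $i$-th row is the $i$-th row of some matrix in $M$ (the matrix in $M$ may depend on $i$). An admissible diagonal nonlinearity is a continuous map $f:\mathbb{R}^n\to\mathbb{R}^n$ of the form $f(x)=(f_1(x_1),\ldots,f_n(x_n))^T$ such that for each $i$: $x_if_i(x_i)>0$ for all $x_i\ne 0$, and $|f_i(x_i)|\le|x_i|$ for all $x_i$. The switching signal $\sigma$ maps the nonnegative integers to $\{1,\ldots,N\}$. The switched system has the associated family of subsystems $x(k+1)=A_sf(x(k))+B_sf(x(k-l))$, $s=1,\ldots,N$. Write $x^{(k)}=(x^T(k),x^T(k-1),\ldots,x^T(k-l))^T\in\mathbb{R}^{(l+1)n}$.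 The switched system is called diagonally stable if there exist positive definite diagonal matrices $P,Q_1,\ldots,Q_l\in\mathbb{R}^{n\times n}$ such that the functional $$V(x^{(k)})=x^T(k)Px(k)+f^T(x(k-1))Q_1f(x(k-1))+\ldots+f^T(x(k-l))Q_lf(x(k-l))$$ has negative difference $V(x^{(k+1)})-V(x^{(k)})$ along the trajectories of every subsystem, i.e. for every $s\in\{1,\ldots,N\}$ and every $x^{(k)}\ne 0$, where $x(k+1)$ is given by the $s$-th subsystem. *)

(* Defs.v *)
From HB Require Import structures.
From mathcomp Require Import all_boot all_order all_algebra.
From mathcomp Require Import all_classical all_reals all_analysis.
From mathcomp Require Import complex.
Set Implicit Arguments.
Unset Strict Implicit.
Unset Printing Implicit Defensive.
Import Order.TTheory GRing.Theory Num.Theory numFieldNormedType.Exports.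
Local Open Scope classical_set_scope.
Local Open Scope ring_scope.

Definition spectrum (R : realType) n (A : 'M[R]_n) : set R[i] :=
  [set z | eigenvalue (map_mx (real_complex R) A) z].

(* For n > 0 this supremum is a maximum: see [spectral_radiusP]. *)
Definition spectral_radius (R : realType) n (A : 'M[R]_n) : R :=
  sup [set Normc.normc z | z in spectrum A].

Definition row_selection (R : realType) n (M : set 'M[R]_n) : set 'M[R]_n :=
  [set C | forall i, exists2 D, M D & row i C = row i D].

(* For M finite and nonempty and n > 0 this supremum is a maximum:
   see [max_spectral_radiusP]. *)
Definition max_spectral_radius (R : realType) n (M : set 'M[R]_n) : R :=
  sup [set spectral_radius C | C in row_selection M].

Definition admissible (R : realType) n (f : 'cV[R]_n -> 'cV[R]_n) : Prop :=
  continuous f /\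
  exists2 g : 'I_n -> R -> R,
    forall x i, f x i 0 = g i (x i 0) &
    forall i u, (u != 0 -> 0 < u * g i u) /\ `|g i u| <= `|u|.

Definition posdefmx (R : realType) n (P : 'M[R]_n) : Prop :=
  P^T = P /\ forall x : 'cV[R]_n, x != 0 -> 0 < (x^T *m P *m x) 0 0.

Definition posdef_diag (R : realType) n (P : 'M[R]_n) : Prop :=
  is_diag_mx P /\ posdefmx P.

(* The vector (x(k), x(k-1), ..., x(k-l)) of R^((l+1)n), kept as a family of
   blocks: the block of index j is x(k-j). *)
Definition history (R : realType) n l := {ffun 'I_l.+1 -> 'cV[R]_n}.

(* The history at time k+1 under x(k+1) = A f(x(k)) + B f(x(k-l)): the new block
   enters at index 0, the block of index j moves to index j+1, and x(k-l) is
   dropped. *)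
Definition next_history (R : realType) n l (f : 'cV[R]_n -> 'cV[R]_n)
    (A B : 'M[R]_n) (X : history R n l) : history R n l :=
  [ffun j => if unlift ord0 j is Some i then X (widen_ord (leqnSn l) i)
             else A *m f (X ord0) + B *m f (X ord_max)].

(* Q is indexed from 0: [Q i] weights f(x(k-(i+1))). *)
Definition lyapunov (R : realType) n l (f : 'cV[R]_n -> 'cV[R]_n)
    (P : 'M[R]_n) (Q : 'I_l -> 'M[R]_n) (X : history R n l) : R :=
  ((X ord0)^T *m P *m X ord0) 0 0 +
  \sum_(i < l) ((f (X (lift ord0 i)))^T *m Q i *m f (X (lift ord0 i))) 0 0.

(* Diagonal stability of x(k+1) = A_sigma(k) f(x(k)) + B_sigma(k) f(x(k-l)).
   The condition bears on every subsystem at every nonzero history, so the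
   switching signal sigma does not occur in it. *)
Definition diagonally_stable (R : realType) n N l (f : 'cV[R]_n -> 'cV[R]_n)
    (A B : 'I_N -> 'M[R]_n) : Prop :=
  exists (P : 'M[R]_n) (Q : 'I_l -> 'M[R]_n),
    [/\ posdef_diag P, forall i, posdef_diag (Q i) &
        forall s (X : history R n l), X != 0 ->
          lyapunov f P Q (next_history f (A s) (B s) X) - lyapunov f P Q X < 0].
Arguments diagonally_stable {R n N} l f A B.

Lemma sup_finite_mem (R : realType) (S : set R) :
  finite_set S -> S !=set0 -> S (sup S) /\ ubound S (sup S).
Proof.
move=> /finite_seqP[s Ss] [x0 Sx0].
have [m Sm mub] : exists2 m, S m & ubound S m.
  have {}Sx0 : x0 \in s by move: Sx0; rewrite Ss.
  exists (\big[Order.max/x0]_(y <- s) y); rewrite Ss /=.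
    rewrite big_seq; apply: (big_ind (fun y => y \in s)) => // y z ys zs.
    by rewrite /Order.max; case: ifP.
  by move=> y /= ys; apply: (@Order.TotalTheory.le_bigmax_seq _ _ _ _ _ y predT id).
have -> : sup S = m; last by [].
by apply/eqP; rewrite eq_le ge_sup ?ub_le_sup //; exists m.
Qed.

Lemma spectral_radiusP (R : realType) n (A : 'M[R]_n) : (0 < n)%N ->
  (exists2 z, spectrum A z & spectral_radius A = Normc.normc z) /\
  (forall z, spectrum A z -> Normc.normc z <= spectral_radius A).
Proof.
move=> n_gt0; set p := char_poly (map_mx (real_complex R) A).
have specE z : spectrum A z <-> root p z.
  by rewrite /spectrum /= eigenvalue_root_char.
have p_neq0 : p != 0 by rewrite monic_neq0 ?char_poly_monic.
have [r pE] := closed_field_poly_normal p.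
have fin : finite_set (spectrum A).
  apply: (@sub_finite_set _ _ [set` r]); last exact: finite_seq.
  move=> z /specE; rewrite pE rootZ ?lead_coef_eq0 //.
  by rewrite root_prod_XsubC.
have ne : spectrum A !=set0.
  have : size p != 1%N by rewrite size_char_poly eqSS -lt0n.
  by move=> /closed_rootP[z pz]; exists z; apply/specE.
have [|[z sz ez] ub] := @sup_finite_mem _
    [set Normc.normc z | z in spectrum A] (finite_image _ fin).
  by have [z sz] := ne; exists (Normc.normc z); exists z.
split; first by exists z => //; rewrite ez.
by move=> y sy; apply: ub; exists y.
Qed.

Lemma max_spectral_radiusP (R : realType) n (M : set 'M[R]_n) :
    finite_set M -> M !=set0 ->
  (exists2 C, row_selection M C & max_spectral_radius M = spectral_radius C) /\
  (forall C, row_selection M C -> spectral_radius C <= max_spectral_radius M).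
Proof.
move=> /finite_seqP[s Ms] [D0 MD0].
have fin : finite_set (row_selection M).
  pose T := {ffun 'I_n -> 'I_(size s)}.
  pose h (t : T) := \matrix_(i, j) nth D0 s (t i) i j : 'M[R]_n.
  apply: (@sub_finite_set _ _ [set` codom h]); last exact: finite_seq.
  move=> C selC /=.
  have /choice[t tP] i : exists k : 'I_(size s), row i C = row i (nth D0 s k).
    have [D MD CD] := selC i.
    have Ds : (index D s < size s)%N by rewrite index_mem; rewrite Ms in MD.
    by exists (Ordinal Ds); rewrite /= nth_index // -index_mem.
  suff -> : C = h [ffun i => t i] by exact: codom_f.
  apply/matrixP => i j; rewrite !mxE ffunE.
  by have /rowP/(_ j) := tP i; rewrite !mxE.
have [|[C selC eC] ub] := @sup_finite_mem _
    [set spectral_radius C | C in row_selection M] (finite_image _ fin).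
  by exists (spectral_radius D0); exists D0 => // i; exists D0.
split; first by exists C => //; rewrite eC.
by move=> D selD; apply: ub; exists D.
Qed.

(* Main.v *)
Require Import Defs.
From mathcomp Require Import all_boot all_order all_algebra.
From mathcomp Require Import all_classical all_reals all_analysis.
From mathcomp Require Import complex polyrcf lra ring.
Import Order.TTheory GRing.Theory Num.Theory numFieldNormedType.Exports.
Local Open Scope classical_set_scope.
Local Open Scope ring_scope.

(** Linear estimates on two positive vectors give the quadratic Lyapunov
estimate.  Choose [lam > rho1] and [mu > rho2] with [lam * mu < 1].  There are
positive vectors [v] and [w] with [(A_s + B_s) v <= mu v] and
[(A_s + B_r)^T w <= lam w] for all [s] and [r].  Take [P = diag (w_j / v_j)].
Since [A_s] and [B_s] are nonnegative, the Cauchy-Schwarz inequality with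
weights [v] bounds the new quadratic term ([sum_scaled_sqr_le]):

  (A_s y + B_s z)^T P (A_s y + B_s z)
     <= mu * sum_j ((A_s^T w)_j y_j^2 + (B_s^T w)_j z_j^2) / v_j,

where [y = f(x(k))] and [z = f(x(k-l))].  Let [b_j] be the maximum over [r] of
[(B_r^T w)_j].  Then [(A_s^T w)_j + b_j <= lam w_j]; this is where the indices
[s] and [r] in [rho1] have to be independent.  So a weight [mu b_j / v_j] for
the delayed terms pays for [z] and leaves the margin [(1 - lam mu) w_j / v_j]
in the coefficient of [y_j^2].  Making the weights of [Q_1, ..., Q_l] decrease
arithmetically spreads this margin evenly over the [l + 1] blocks
([sum_affine_weights_shift]), so that the difference is at most minus a sum
of positive multiples of all the [f(x(k-i))_j^2].  This is strictly negative at
nonzero histories because [f] vanishes only at 0, and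
[f(x)_j^2 <= x_j^2] lets [P] be compared with [y] in place of [x(k)].

The vectors [v] and [w] come from [exists_common_supersolution]: if all row
selections of a finite family of nonnegative matrices have spectral radius
below [mu], one positive vector [v] satisfies [C v <= mu v] for the whole
family.  It is found by policy iteration: among all row selections [C], the
one for which the entries of [(mu - C)^-1 1] have the largest sum cannot be
improved by changing a row.  The positivity of [(mu - C)^-1 1] is the part of
Perron-Frobenius theory that is used.  It is proved by lowering [t] from
infinity to [mu]: the inverse of [t - C] stays nonnegative as long as it
exists ([exists_strict_supersolution]). *)

(** * Nonnegative matrices below a spectral bound *)

(** A strict supersolution [v] acts as a barrier: at an index where [x / v] is
minimal, a negative minimum would contradict [C v < t v].  This is the
maximum principle that makes the inverse of [t - C] nonnegative. *)
Lemma supersolution_nonneg (R : realFieldType) (n : nat) (C : 'M[R]_n)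
    (t : R) (v x : 'cV[R]_n) :
    (forall i j, 0 <= C i j) -> (forall i, 0 < v i 0) ->
    (forall i, (C *m v) i 0 < t * v i 0) ->
    (forall i, (C *m x) i 0 <= t * x i 0) ->
  forall i, 0 <= x i 0.
Proof.
move=> C_ge0 v_gt0 Cv Cx i0.
case: (@arg_minP _ _ _ i0 xpredT (fun i => x i 0 / v i 0)) => // i _ i_min.
have [m_ge0|m_lt0] := leP 0 (x i 0 / v i 0).
  have := le_trans m_ge0 (i_min i0 isT).
  by rewrite pmulr_lge0 // invr_gt0.
set m := x i 0 / v i 0 in m_lt0 i_min.
have x_ge j : m * v j 0 <= x j 0 by rewrite -ler_pdivlMr // i_min.
have : m * (C *m v) i 0 <= (C *m x) i 0.
  rewrite !mxE mulr_sumr; apply: ler_sum => j _.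
  by rewrite mulrCA ler_wpM2l.
have : t * x i 0 < m * (C *m v) i 0.
  by rewrite -[x i 0](divfK (lt0r_neq0 (v_gt0 i))) mulrCA ltr_nM2l // Cv.
move=> lt1 le1; have := lt_le_trans lt1 (le_trans le1 (Cx i)).
by rewrite ltxx.
Qed.

Lemma horner_ge0_right_limit (R : realType) (p : {poly R}) (t0 : R) :
  (forall t, t0 < t -> 0 <= p.[t]) -> 0 <= p.[t0].
Proof.
move=> p_ge0; rewrite leNgt; apply/negP => p_lt0.
have [|d d_gt0 dP] := @poly_cont _ t0 p (- p.[t0]); first by rewrite oppr_gt0.
have near : `|p.[t0 + d / 2] - p.[t0]| < - p.[t0].
  apply: dP; rewrite addrAC subrr add0r gtr0_norm ?divr_gt0 //.
  by rewrite ltr_pdivrMr // ltr_pMr // ltr1n.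
have := le_lt_trans (ler_norm _) near.
by rewrite ltrBlDr addNr ltNge p_ge0 // ltrDl divr_gt0.
Qed.

Lemma eval_char_poly_mx (R : comNzRingType) (n : nat) (C : 'M[R]_n) (t : R) :
  map_mx (horner_eval t) (char_poly_mx C) = t%:M - C.
Proof.
apply/matrixP => i j.
by rewrite !mxE /horner_eval hornerD hornerN hornerC hornerMn hornerX.
Qed.

Lemma horner_char_poly (R : comNzRingType) (n : nat) (C : 'M[R]_n) (t : R) :
  (char_poly C).[t] = \det (t%:M - C).
Proof. by rewrite -eval_char_poly_mx det_map_mx. Qed.

(** Let [t0] be the infimum of the [t] that admit a strict supersolution.  If
[mu <= t0], then [t0 - C] is invertible, and [x = (t0 - C)^-1 1] is the limit
of the nonnegative vectors [(t - C)^-1 1] for [t > t0].  So [x] is nonnegative,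
[t0 x = 1 + C x] makes it positive, and it is still a strict supersolution
slightly below [t0]: a contradiction. *)
Lemma exists_strict_supersolution (R : realType) (n : nat) (C : 'M[R]_n)
    (mu : R) : (0 < n)%N -> 0 < mu ->
    (forall i j, 0 <= C i j) ->
    (forall t, mu <= t -> \det (t%:M - C) != 0) ->
  exists2 v : 'cV[R]_n, (forall i, 0 < v i 0) &
    forall i, (C *m v) i 0 < mu * v i 0.
Proof.
move=> n_gt0 mu_gt0 C_ge0 det_neq0.
pose S := [set t | exists2 v : 'cV[R]_n, (forall i, 0 < v i 0) &
    forall i, (C *m v) i 0 < t * v i 0].
have Cv_ge0 (v : 'cV[R]_n) i : (forall i, 0 < v i 0) -> 0 <= (C *m v) i 0.
  by move=> v_gt0; rewrite mxE sumr_ge0 // => j _; rewrite mulr_ge0 // ltW.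
have S_lb : has_lbound S.
  exists 0 => t [v v_gt0 Cv]; have := Cv (Ordinal n_gt0).
  by move/(le_lt_trans (Cv_ge0 _ _ v_gt0)); rewrite pmulr_lgt0 // => /ltW.
have S_neq0 : S !=set0.
  exists (1 + \sum_i (C *m const_mx 1 : 'cV[R]_n) i 0), (const_mx 1).
    by move=> i; rewrite mxE.
  move=> i; rewrite [X in _ * X]mxE mulr1 (bigD1 i) //= addrCA ltrDl.
  rewrite ltr_pwDl // sumr_ge0 // => j _; apply: Cv_ge0 => k; rewrite mxE //.
have S_up s t : S s -> s <= t -> S t.
  move=> [v v_gt0 Cv] st; exists v => // i; apply: lt_le_trans (Cv i) _.
  by rewrite ler_wpM2r // ltW.
have [t0_lt_mu|mu_le_t0] := ltP (inf S) mu.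
  by have [s Ss /ltW] := inf_lt S_neq0 t0_lt_mu; exact: S_up.
set t0 := inf S in mu_le_t0; exfalso.
(* By Cramer's rule the entries of (t - C)^-1 1 are rational functions of t. *)
pose num : 'cV[{poly R}]_n := \adj (char_poly_mx C) *m const_mx 1.
pose chi := char_poly C.
pose v t : 'cV[R]_n := \col_i ((num i 0).[t] / chi.[t]).
have v_eq t i : mu <= t -> (C *m v t) i 0 = t * v t i 0 - 1.
  move=> mu_le_t.
  have chi_neq0 : chi.[t] != 0 by rewrite horner_char_poly det_neq0.
  have : (t%:M - C) *m v t = const_mx 1.
    have -> : v t = chi.[t]^-1 *: map_mx (horner_eval t) num.
      by apply/colP => k; rewrite !mxE mulrC.
    rewrite -scalemxAr map_mxM map_mx_adj eval_char_poly_mx mulmxA mul_mx_adj.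
    rewrite -horner_char_poly -/chi mul_scalar_mx scalerA mulVf // scale1r.
    by apply/colP => k; rewrite !mxE rmorph1.
  move/colP/(_ i); rewrite mulmxBl mul_scalar_mx !mxE; lra.
(* The sign of a quotient is that of the product, which is a polynomial in t. *)
have v_ge0E t i : mu <= t -> (0 <= v t i 0) = (0 <= (num i 0 * chi).[t]).
  move=> /det_neq0; rewrite -horner_char_poly -/chi => chi_neq0.
  have chi2 : 0 < chi.[t] ^+ 2 by rewrite exprn_even_gt0.
  by rewrite -(pmulr_lge0 _ chi2) mxE hornerM expr2 mulrA divfK.
have v_ge0 i : 0 <= v t0 i 0.
  rewrite v_ge0E //; apply: horner_ge0_right_limit => t t0_lt_t.
  have mu_le_t : mu <= t := le_trans mu_le_t0 (ltW t0_lt_t).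
  have [s Ss /ltW/(S_up _ _ Ss)[u u_gt0 Cu]] := inf_lt S_neq0 t0_lt_t.
  rewrite -v_ge0E //.
  apply: (supersolution_nonneg _ _ _ _ _ (v t) C_ge0 u_gt0 Cu) => k.
  by rewrite v_eq // gerDl oppr_le0.
have t0_gt0 : 0 < t0 := lt_le_trans mu_gt0 mu_le_t0.
have v_gt0 i : 0 < v t0 i 0.
  rewrite -(pmulr_rgt0 _ t0_gt0) (lt_le_trans ltr01) // -subr_ge0 -v_eq //.
  by rewrite mxE sumr_ge0 // => j _; rewrite mulr_ge0.
(* C v = t0 v - 1 < (t0 - e) v as soon as e v < 1 in all entries. *)
pose K := 1 + \sum_i v t0 i 0.
have K_gt0 : 0 < K by rewrite ltr_pwDl // sumr_ge0.
have : S (t0 - K^-1).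
  exists (v t0) => // i; rewrite v_eq // mulrBl ltrD2l ltrN2.
  rewrite mulrC ltr_pdivrMr // mul1r /K (bigD1 i) //= addrCA ltrDl.
  by rewrite ltr_pwDl // sumr_ge0.
move/(ge_inf S_lb).
by rewrite -/t0 lerBrDr gerDl leNgt invr_gt0 K_gt0.
Qed.

Lemma det_neq0_above_spectral_radius (R : realType) (n : nat) (C : 'M[R]_n)
    (t : R) : (0 < n)%N ->
  spectral_radius C < t -> \det (t%:M - C) != 0.
Proof.
move=> n_gt0 rho_lt_t; rewrite -horner_char_poly.
apply/negP => t_root.
have [_ /(_ (real_complex R t))] := spectral_radiusP C n_gt0.
rewrite /spectrum /= eigenvalue_root_char -map_char_poly fmorph_root.
move=> /(_ t_root); rewrite expr0n addr0 sqrtr_sqr.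
by move=> /(le_trans (ler_norm t)); rewrite leNgt rho_lt_t.
Qed.

Lemma spectral_radius_ge0 (R : realType) (n : nat) (C : 'M[R]_n) :
  (0 < n)%N -> 0 <= spectral_radius C.
Proof. by move=> /(spectral_radiusP C)[[[a b] _ ->] _]; exact: sqrtr_ge0. Qed.

(** The equation [mu v - C v = 1] replaces the inequality of
[exists_strict_supersolution] because solutions for different matrices can then
be subtracted, which the policy iteration below relies on. *)
Lemma exists_resolvent_of_one (R : realType) (n : nat) (C : 'M[R]_n)
    (mu : R) : (0 < n)%N -> (forall i j, 0 <= C i j) ->
    spectral_radius C < mu ->
  exists2 v : 'cV[R]_n, (forall i, 0 < v i 0) &
    forall i, (C *m v) i 0 = mu * v i 0 - 1.
Proof.
move=> n_gt0 C_ge0 rho_lt_mu.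
have mu_gt0 : 0 < mu := le_lt_trans (spectral_radius_ge0 _ _ C n_gt0) rho_lt_mu.
have det_neq0 t : mu <= t -> \det (t%:M - C) != 0.
  by move=> /(lt_le_trans rho_lt_mu); exact: det_neq0_above_spectral_radius.
have [u u_gt0 Cu] :=
  exists_strict_supersolution _ _ _ _ n_gt0 mu_gt0 C_ge0 det_neq0.
have unit : mu%:M - C \in unitmx by rewrite unitmxE unitfE det_neq0.
pose v : 'cV[R]_n := invmx (mu%:M - C) *m const_mx 1.
have vE i : (C *m v) i 0 = mu * v i 0 - 1.
  have /colP/(_ i) := mulKVmx unit (const_mx 1 : 'cV[R]_n); rewrite -/v.
  by rewrite mulmxBl mul_scalar_mx !mxE; lra.
have v_ge0 : forall i, 0 <= v i 0.
  apply: (supersolution_nonneg _ _ _ _ _ v C_ge0 u_gt0 Cu) => k.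
  by rewrite vE gerDl oppr_le0.
exists v => // i; rewrite -(pmulr_rgt0 _ mu_gt0) (lt_le_trans ltr01) //.
by rewrite -subr_ge0 -vE mxE sumr_ge0 // => j _; rewrite mulr_ge0.
Qed.

(** Policy iteration.  For a row selection [p] let [V p] be the solution of
[mu x - C x = 1], where [C] is the selected matrix, and take [p] such that the
sum of the entries of [V p] is maximal.  If some matrix of the family had a row
violating the bound at [v = V p], selecting this row would give [p'] with
[V p' >= V p] by [supersolution_nonneg], hence [V p' = V p] by maximality,
although the equation at that row has changed. *)
Lemma exists_common_supersolution (R : realType) (n : nat) (T : finType)
    (s0 : T) (F : T -> 'M[R]_n) (mu : R) :
    (0 < n)%N -> (forall s i j, 0 <= F s i j) ->
    (forall p : 'I_n -> T,
       spectral_radius (\matrix_(i, j) F (p i) i j) < mu) ->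
  exists2 v : 'cV[R]_n, (forall i, 0 < v i 0) &
    forall s i, (F s *m v) i 0 <= mu * v i 0.
Proof.
move=> n_gt0 F_ge0 rho_lt_mu.
pose sel (p : {ffun 'I_n -> T}) : 'M[R]_n := \matrix_(i, j) F (p i) i j.
have sel_ge0 p i j : 0 <= sel p i j by rewrite mxE.
have sel_mul p (x : 'cV[R]_n) i : (sel p *m x) i 0 = (F (p i) *m x) i 0.
  by rewrite !mxE; apply: eq_bigr => j _; rewrite mxE.
have /choice[V VP] (p : {ffun 'I_n -> T}) : exists v : 'cV[R]_n,
    (forall i, 0 < v i 0) /\ forall i, (F (p i) *m v) i 0 = mu * v i 0 - 1.
  have [v v_gt0 vE] :=
    exists_resolvent_of_one _ _ _ _ n_gt0 (sel_ge0 p) (rho_lt_mu p).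
  by exists v; split => // i; rewrite -sel_mul.
case: (@arg_maxP _ _ _ [ffun=> s0] xpredT (fun p => \sum_i V p i 0)) => // p _.
move=> p_max; have [v_gt0 vE] := VP p; exists (V p) => // s i.
rewrite leNgt; apply/negP => improve.
pose p' := [ffun k => if k == i then s else p k].
have [w_gt0 wE] := VP p'.
have p'i : p' i = s by rewrite ffunE eqxx.
have subE (x y : 'cV[R]_n) k : (x - y) k 0 = x k 0 - y k 0 by rewrite !mxE.
(* At the modified row the excess of F s v over mu v becomes a strict gain. *)
have better_at_i : (F s *m (V p' - V p)) i 0 < mu * (V p' - V p) i 0.
  rewrite mulmxBr !subE -{1}p'i wE; lra.
have better : forall k, 0 <= (V p' - V p) k 0.
  apply: (supersolution_nonneg _ _ (sel p') mu (V p')) => // k; rewrite sel_mul.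
    by rewrite wE gtrDl oppr_lt0.
  have [->|ki] := eqVneq k i; first by rewrite p'i ltW.
  rewrite mulmxBr !subE wE ffunE (negPf ki) vE; lra.
have sum_le0 : \sum_k (V p' - V p) k 0 <= 0.
  under eq_bigr do rewrite subE.
  rewrite big_split sumrN subr_le0; exact: p_max.
have V_eq : V p' - V p = 0.
  apply/colP => k; rewrite [RHS]mxE; apply: le_anti; rewrite better andbT.
  apply: le_trans sum_le0.
  by rewrite (bigD1 k) //= lerDl sumr_ge0.
by move: better_at_i; rewrite V_eq mulmx0 mxE mulr0 ltxx.
Qed.

(** * Quadratic estimates *)

(** With [c = Y / m], where [Y] is the sum on the left, this is the sum of the
inequalities [a (y - c v)^2 / v >= 0].  An upper bound [m] of [sum a v] replaces
that sum itself, so that no case distinction is needed when it vanishes. *)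
Lemma weighted_cauchy_schwarz (R : realFieldType) (I : finType)
    (a v y : I -> R) (m : R) :
    (forall k, 0 <= a k) -> (forall k, 0 < v k) -> 0 < m ->
    \sum_k a k * v k <= m ->
  (\sum_k a k * y k) ^+ 2 <= m * \sum_k a k * (y k ^+ 2 / v k).
Proof.
move=> a_ge0 v_gt0 m_gt0 av_le_m.
set Y := \sum_k a k * y k; pose c := Y / m.
have Yc : Y = c * m by rewrite divfK // gt_eqF.
have : 2 * c * Y - c ^+ 2 * \sum_k a k * v k <= \sum_k a k * (y k ^+ 2 / v k).
  rewrite /Y !mulr_sumr -sumrB; apply: ler_sum => k _; rewrite -subr_ge0.
  have -> : a k * (y k ^+ 2 / v k) - (2 * c * (a k * y k) - c ^+ 2 * (a k * v k))
      = a k * ((y k - c * v k) ^+ 2 / v k).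
    by field; rewrite gt_eqF.
  by rewrite mulr_ge0 // divr_ge0 ?sqr_ge0 // ltW.
have : c ^+ 2 * \sum_k a k * v k <= c ^+ 2 * m by rewrite ler_wpM2l ?sqr_ge0.
move=> le1 le2; have -> : Y ^+ 2 = m * (c ^+ 2 * m) by rewrite Yc; ring.
rewrite ler_pM2l //; rewrite Yc in le2.
have : 2 * c * (c * m) = 2 * (c ^+ 2 * m) by ring.
lra.
Qed.

(** Cauchy-Schwarz is applied to each row of the block matrix [(A, B)] with
weights [(v, v)]; the entry [mu v_i] that bounds the total weight of row [i]
cancels against [w_i / v_i], and what remains is linear in [w]. *)
Lemma sum_scaled_sqr_le (R : realFieldType) (n : nat) (A B : 'M[R]_n)
    (v w y z : 'cV[R]_n) (mu : R) :
    (forall i j, 0 <= A i j) -> (forall i j, 0 <= B i j) ->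
    (forall i, 0 < v i 0) -> (forall i, 0 < w i 0) -> 0 < mu ->
    (forall i, ((A + B) *m v) i 0 <= mu * v i 0) ->
  \sum_i w i 0 / v i 0 * ((A *m y + B *m z) i 0) ^+ 2 <=
  \sum_j mu * ((A^T *m w) j 0 * (y j 0 ^+ 2 / v j 0) +
               (B^T *m w) j 0 * (z j 0 ^+ 2 / v j 0)).
Proof.
move=> A_ge0 B_ge0 v_gt0 w_gt0 mu_gt0 ABv.
have row_le i : w i 0 / v i 0 * ((A *m y + B *m z) i 0) ^+ 2 <=
    \sum_j mu * (A i j * w i 0 * (y j 0 ^+ 2 / v j 0) +
                 B i j * w i 0 * (z j 0 ^+ 2 / v j 0)).
  (* The columns of (A, B) are indexed by the sum of two copies of 'I_n. *)
  pose pick (a b : 'I_n -> R) (k : 'I_n + 'I_n) :=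
    match k with inl j => a j | inr j => b j end.
  have pick_sum (F : 'I_n + 'I_n -> R) :
      \sum_k F k = \sum_j (F (inl j) + F (inr j)).
    by rewrite big_sumType big_split.
  have /(_ _ _ _ _)/[!pick_sum] := @weighted_cauchy_schwarz R ('I_n + 'I_n)%type
    (pick (A i) (B i)) (pick (v^~ 0) (v^~ 0)) (pick (y^~ 0) (z^~ 0))
    (mu * v i 0).
  move=> /= cs.
  have -> : (A *m y + B *m z) i 0 = \sum_j (A i j * y j 0 + B i j * z j 0).
    by rewrite !mxE -big_split.
  have -> : \sum_j mu * (A i j * w i 0 * (y j 0 ^+ 2 / v j 0) +
                         B i j * w i 0 * (z j 0 ^+ 2 / v j 0)) =
      w i 0 / v i 0 * (mu * v i 0 * \sum_j
        (A i j * (y j 0 ^+ 2 / v j 0) + B i j * (z j 0 ^+ 2 / v j 0))).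
    rewrite !mulr_sumr; apply: eq_bigr => j _.
    by field; rewrite !gt_eqF.
  rewrite ler_pM2l ?divr_gt0 //; apply: cs.
  - by case=> j; [exact: A_ge0|exact: B_ge0].
  - by case=> j; exact: v_gt0.
  - exact: mulr_gt0.
  - apply: le_trans (ABv i); rewrite mxE le_eqVlt; apply/orP; left; apply/eqP.
    by apply: eq_bigr => j _; rewrite mxE mulrDl.
have trE (M : 'M[R]_n) j : (M^T *m w) j 0 = \sum_i M i j * w i 0.
  by rewrite mxE; apply: eq_bigr => i _; rewrite mxE.
rewrite (le_trans (ler_sum _ (fun i _ => row_le i))) // exchange_big /=.
apply: ler_sum => j _; rewrite -mulr_sumr ler_pM2l // big_split /=.
by rewrite !trE -!mulr_suml.
Qed.

(** Shifting the blocks by one moves each intermediate block from one weight to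
the next smaller one, a loss of [eta].  The boundary terms are written as if the
weights continued to [beta + (l + 1) eta] before the first block and to [beta]
after the last, so that the loss is the same for all [l + 1] blocks. *)
Lemma sum_affine_weights_shift (R : comNzRingType) (l : nat) (beta eta : R)
    (u : 'I_l.+1 -> R) :
  \sum_(i < l) (beta + (l - i)%:R * eta) * u (widen_ord (leqnSn l) i) -
  \sum_(i < l) (beta + (l - i)%:R * eta) * u (lift ord0 i) =
  (beta + l.+1%:R * eta) * u ord0 - beta * u ord_max - eta * \sum_i u i.
Proof.
pose W := \sum_(i < l.+1) (beta + (l - i)%:R * eta) * u i.
have WM : W = \sum_(i < l) (beta + (l - i)%:R * eta) * u (widen_ord (leqnSn l) i)
    + beta * u ord_max.
  by rewrite /W big_ord_recr /= subnn mul0r addr0.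
have W0 : W = (beta + l%:R * eta) * u ord0 +
    (\sum_(i < l) (beta + (l - i)%:R * eta) * u (lift ord0 i)
     - eta * \sum_(i < l) u (lift ord0 i)).
  rewrite /W big_ord_recl /= subn0 mulr_sumr -sumrB; congr (_ + _).
  apply: eq_bigr => i _; rewrite /bump /= add1n.
  by rewrite -(subnSK (ltn_ord i)) -natr1; ring.
rewrite big_ord_recl -natr1.
have -> : \sum_(i < l) (beta + (l - i)%:R * eta) * u (widen_ord (leqnSn l) i) =
  W - beta * u ord_max by rewrite WM addrK.
rewrite W0; ring.
Qed.

Lemma diag_quadratic_form (R : comNzRingType) (n : nat) (d : 'rV[R]_n)
    (x : 'cV[R]_n) :
  (x^T *m diag_mx d *m x) 0 0 = \sum_j d 0 j * x j 0 ^+ 2.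
Proof.
rewrite -mulmxA mul_diag_mx mxE; apply: eq_bigr => j _.
by rewrite !mxE expr2 mulrCA.
Qed.

Lemma posdef_diag_mx (R : realType) (n : nat) (d : 'rV[R]_n) :
  (forall j, 0 < d 0 j) -> posdef_diag (diag_mx d).
Proof.
move=> d_gt0; split; first exact: diag_mx_is_diag.
split=> [|x]; first exact: tr_diag_mx.
move=> /matrix0Pn[i [k]]; rewrite (ord1 k) => xi.
rewrite diag_quadratic_form (bigD1 i) //= ltr_pwDl //.
  by rewrite mulr_gt0 // exprn_even_gt0.
by rewrite sumr_ge0 // => j _; rewrite mulr_ge0 ?sqr_ge0 // ltW.
Qed.

(** * Common supersolutions for finite families *)

Lemma finite_set_range (T : finType) (U : Type) (F : T -> U) :
  finite_set (range F).
Proof. by apply: finite_image; exact: finite_finset. Qed.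

Lemma common_supersolution_above_max_radius (R : realType) (n : nat)
    (T : finType) (s0 : T) (F : T -> 'M[R]_n) (mu : R) :
    (0 < n)%N -> (forall s i j, 0 <= F s i j) ->
    max_spectral_radius (range F) < mu ->
  exists2 v : 'cV[R]_n, (forall i, 0 < v i 0) &
    forall s i, (F s *m v) i 0 <= mu * v i 0.
Proof.
move=> n_gt0 F_ge0 rho_lt_mu; apply: exists_common_supersolution => // p.
apply: le_lt_trans rho_lt_mu.
have [||_] := @max_spectral_radiusP R n (range F).
- exact: finite_set_range.
- by exists (F s0), s0.
apply=> i; exists (F (p i)); first by exists (p i).
by apply/rowP => j; rewrite !mxE.
Qed.

Lemma max_spectral_radius_ge0 (R : realType) (n : nat) (T : finType)
    (s0 : T) (F : T -> 'M[R]_n) :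
  (0 < n)%N -> 0 <= max_spectral_radius (range F).
Proof.
move=> n_gt0; have [||[C _ ->] _] := @max_spectral_radiusP R n (range F).
- exact: finite_set_range.
- by exists (F s0), s0.
- exact: spectral_radius_ge0.
Qed.

(** * The Lyapunov functional *)

Lemma exists_larger_factors (R : realFieldType) (a b : R) :
  0 <= a -> 0 <= b -> a * b < 1 ->
  exists x y : R, [/\ a < x, b < y & x * y < 1].
Proof.
move=> a_ge0 b_ge0 ab_lt1; pose e := (1 - a * b) / (2 * (1 + a + b)).
have s_gt0 : 0 < 1 + a + b by lra.
have e_gt0 : 0 < e by rewrite divr_gt0 //; lra.
have eE : e * (1 + a + b) = (1 - a * b) / 2.
  by rewrite /e; field; lra.
have ab_ge0 : 0 <= a * b by rewrite mulr_ge0.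
have e_le1 : e <= 1 by nra.
exists (a + e), (b + e); split; [lra|lra|].
nra.
Qed.

Lemma admissible_sqr_le (R : realType) (n : nat) (f : 'cV[R]_n -> 'cV[R]_n)
    (x : 'cV[R]_n) (i : 'I_n) :
  admissible f -> f x i 0 ^+ 2 <= x i 0 ^+ 2.
Proof.
move=> [_ [g fE g_sector]]; rewrite fE -ler_sqrt ?sqr_ge0 // !sqrtr_sqr.
by have [] := g_sector i (x i 0).
Qed.

Lemma admissible_neq0 (R : realType) (n : nat) (f : 'cV[R]_n -> 'cV[R]_n)
    (x : 'cV[R]_n) (i : 'I_n) :
  admissible f -> x i 0 != 0 -> f x i 0 != 0.
Proof.
move=> [_ [g fE g_sector]] xi; rewrite fE; apply/eqP => gx0.
by have [/(_ xi)] := g_sector i (x i 0); rewrite gx0 mulr0 ltxx.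
Qed.

Lemma next_history0 (R : realType) (n l : nat) (f : 'cV[R]_n -> 'cV[R]_n)
    (A B : 'M[R]_n) (X : history R n l) :
  next_history f A B X ord0 = A *m f (X ord0) + B *m f (X ord_max).
Proof. by rewrite ffunE unlift_none. Qed.

Lemma next_historyS (R : realType) (n l : nat) (f : 'cV[R]_n -> 'cV[R]_n)
    (A B : 'M[R]_n) (X : history R n l) (i : 'I_l) :
  next_history f A B X (lift ord0 i) = X (widen_ord (leqnSn l) i).
Proof. by rewrite ffunE liftK. Qed.

Lemma lyapunov_diag (R : realType) (n l : nat) (f : 'cV[R]_n -> 'cV[R]_n)
    (p : 'rV[R]_n) (q : 'I_l -> 'rV[R]_n) (X : history R n l) :
  lyapunov f (diag_mx p) (fun i => diag_mx (q i)) X =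
  \sum_j p 0 j * X ord0 j 0 ^+ 2 +
  \sum_j \sum_i q i 0 j * f (X (lift ord0 i)) j 0 ^+ 2.
Proof.
rewrite /lyapunov diag_quadratic_form exchange_big /=; congr (_ + _).
by apply: eq_bigr => i _; rewrite diag_quadratic_form.
Qed.

Theorem theorem4p4 (R : realType) (n N l : nat)
    (n_gt0 : (0 < n)%N) (N_gt0 : (0 < N)%N) (l_gt0 : (0 < l)%N)
    (A B : 'I_N -> 'M[R]_n)
    (A_ge0 : forall s i j, 0 <= A s i j) (B_ge0 : forall s i j, 0 <= B s i j)
    (f : 'cV[R]_n -> 'cV[R]_n) (f_adm : admissible f)
    (M1 := [set M | exists s r, M = (A s + B r)^T] : set 'M[R]_n)
    (M2 := [set M | exists s, M = A s + B s] : set 'M[R]_n)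
    (rho1 := max_spectral_radius M1) (rho2 := max_spectral_radius M2) :
  rho1 * rho2 < 1 -> diagonally_stable l f A B.
Proof.
pose s0 : 'I_N := Ordinal N_gt0.
pose F1 (sr : 'I_N * 'I_N) := (A sr.1 + B sr.2)^T.
pose F2 s := A s + B s.
have M1E : M1 = range F1.
  apply/seteqP; split=> [_ [s [r ->]]|_ [[s r] _ <-]].
    by exists (s, r).
  by exists s, r.
have M2E : M2 = range F2.
  apply/seteqP; split=> [_ [s ->]|_ [s _ <-]]; by exists s.
have F1_ge0 sr i j : 0 <= F1 sr i j by rewrite !mxE addr_ge0.
have F2_ge0 s i j : 0 <= F2 s i j by rewrite mxE addr_ge0.
rewrite /rho1 /rho2 M1E M2E => rho_lt1.
have rho2_ge0 := @max_spectral_radius_ge0 R n 'I_N s0 F2 n_gt0.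
have rho1_ge0 :=
  @max_spectral_radius_ge0 R n ('I_N * 'I_N)%type (s0, s0) F1 n_gt0.
have [lam [mu [rho1_lt rho2_lt lam_mu]]] :=
  exists_larger_factors _ _ _ rho1_ge0 rho2_ge0 rho_lt1.
have mu_gt0 : 0 < mu := le_lt_trans rho2_ge0 rho2_lt.
have [v v_gt0 F2v] :=
  common_supersolution_above_max_radius _ _ _ s0 _ _ n_gt0 F2_ge0 rho2_lt.
have [w w_gt0 F1w] :=
  common_supersolution_above_max_radius _ _ _ (s0, s0) _ _ n_gt0 F1_ge0 rho1_lt.
pose a s j := ((A s)^T *m w) j 0.
pose b s j := ((B s)^T *m w) j 0.
have ab_le s r j : a s j + b r j <= lam * w j 0.
  apply: le_trans (F1w (s, r) j).
  by rewrite /F1 /= linearD mulmxDl [in leRHS]mxE.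
have b_ge0 s j : 0 <= b s j.
  by rewrite /b mxE sumr_ge0 // => i _; rewrite mulr_ge0 ?mxE // ltW.
(* The maximum is attained at an index r that may depend on j; ab_le still
   applies to it since s and r are independent there. *)
pose bmax j := b [arg max_(r > s0) b r j]%O j.
have b_le s j : b s j <= bmax j.
  by rewrite /bmax; case: arg_maxP => // r _ /(_ s isT).
(* beta j is the price of the delayed term; (l + 1) * eta j is the margin that
   remains in the coefficient of the undelayed one. *)
pose beta j := mu * bmax j / v j 0.
pose eta j := (1 - lam * mu) * w j 0 / v j 0 / l.+1%:R.
have beta_ge0 j : 0 <= beta j.
  by rewrite divr_ge0 ?mulr_ge0 ?b_ge0 // ltW.
have eta_gt0 j : 0 < eta j.
  by rewrite !divr_gt0 ?mulr_gt0 ?subr_gt0 ?ltr0n.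
pose p := \row_j (w j 0 / v j 0).
pose q (i : 'I_l) := \row_j (beta j + (l - i)%:R * eta j).
exists (diag_mx p), (fun i => diag_mx (q i)); split.
- by apply: posdef_diag_mx => j; rewrite mxE divr_gt0.
- move=> i; apply: posdef_diag_mx => j; rewrite mxE.
  by rewrite ltr_wpDl // mulr_gt0 // ltr0n subn_gt0.
move=> s X X_neq0.
pose u j i := f (X i) j 0 ^+ 2.
rewrite !lyapunov_diag next_history0.
under [in X in X - _]eq_bigr do rewrite mxE.
under [in X in _ + X - _]eq_bigr do
  under eq_bigr do rewrite next_historyS mxE -/(u _ _).
under [in X in _ - (_ + X)]eq_bigr do
  under eq_bigr do rewrite mxE -/(u _ _).
have AB_le : \sum_j w j 0 / v j 0 *
      (A s *m f (X ord0) + B s *m f (X ord_max)) j 0 ^+ 2 <=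
    \sum_j mu * (a s j * (u j ord0 / v j 0) + b s j * (u j ord_max / v j 0)).
  exact: (sum_scaled_sqr_le _ _ (A s) (B s) v w (f (X ord0)) (f (X ord_max))
  mu (A_ge0 s) (B_ge0 s) v_gt0 w_gt0 mu_gt0 (F2v s)).
have p_le : \sum_j w j 0 / v j 0 * u j ord0 <= \sum_j p 0 j * X ord0 j 0 ^+ 2.
  apply: ler_sum => j _; rewrite mxE ler_pM2l ?divr_gt0 //.
  exact: admissible_sqr_le.
have decay : \sum_j eta j * \sum_i u j i > 0.
  have [i Xi] : exists i, X i != 0.
    apply/existsP; rewrite -negb_forall; apply: contra X_neq0 => /forallP X0.
    by apply/eqP/ffunP => i; rewrite [RHS]ffunE; apply/eqP.
  have [j [k]] := matrix0Pn _ Xi; rewrite (ord1 k) => /(admissible_neq0 _ _ f).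
  move=> /(_ f_adm) fij.
  have term_ge0 j' : 0 <= eta j' * \sum_i u j' i.
    apply: mulr_ge0; first exact: ltW.
    by apply: sumr_ge0 => i' _; exact: sqr_ge0.
  rewrite (bigD1 j) //= ltr_pwDl ?sumr_ge0 // mulr_gt0 // (bigD1 i) //=.
  rewrite ltr_pwDl ?exprn_even_gt0 // sumr_ge0 // => i' _; exact: sqr_ge0.
(* Apart from the eta term, the shift leaves only multiples of u j ord0 and
   u j ord_max, whose coefficients are separately nonpositive (le0 and le1). *)
have term_le j : mu * (a s j * (u j ord0 / v j 0) + b s j * (u j ord_max / v j 0))
    - w j 0 / v j 0 * u j ord0 +
    (\sum_(i < l) (beta j + (l - i)%:R * eta j) * u j (widen_ord (leqnSn l) i) -
     \sum_(i < l) (beta j + (l - i)%:R * eta j) * u j (lift ord0 i))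
    <= - (eta j * \sum_i u j i).
  rewrite sum_affine_weights_shift.
  have -> : l.+1%:R * eta j = (1 - lam * mu) * w j 0 / v j 0.
    by rewrite mulrC divfK // pnatr_eq0.
  have le0 : mu * (a s j + bmax j - lam * w j 0) * (u j ord0 / v j 0) <= 0.
    rewrite mulr_le0_ge0 ?divr_ge0 ?sqr_ge0 ?(ltW (v_gt0 j)) //.
    by rewrite pmulr_rle0 // subr_le0 ab_le.
  have le1 : mu * (b s j - bmax j) * (u j ord_max / v j 0) <= 0.
    rewrite mulr_le0_ge0 ?divr_ge0 ?sqr_ge0 ?(ltW (v_gt0 j)) //.
    by rewrite pmulr_rle0 // subr_le0.
  rewrite /beta; lra.
have := ler_sum (index_enum _) (fun j (_ : xpredT j) => term_le j).
move=> /=; rewrite !big_split /= !sumrN.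
move: AB_le p_le decay; lra.
Qed.
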